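(* Let $\alpha,\beta,\gamma$ be real parameters. Then the unified generalized $q$-Stirling matrices $\sigma^1_{\alpha,\beta,\gamma}$ and $\sigma^2_{\alpha,\beta,\gamma}$ satisfy, for all $t$, $$\mathbf{v}_{\alpha}\left([t]_q\right)=\sigma^1_{\alpha,\beta,\gamma}\,\mathbf{v}_{\beta}\left([t]_q-[\gamma]_q\right)$$ and $$\mathbf{v}_{\beta}\left([t]_q\right)=\sigma^2_{\alpha,\beta,\gamma}\,\mathbf{v}_{\alpha}\left([t]_q+[\gamma]_q\right).$$
   Context: Fix a real number $q>0$, $q\neq 1$, and write $[x]_q=\frac{q^x-1}{q-1}$. For a number $x$, a parameter $\alpha$ and an integer $n\ge 0$, put $$\left\langle x\,|\,[\alpha]_q\right\rangle_n=\prod_{j=0}^{n-1}\left(x-[\alpha j]_q\right),\qquad \left\langle x\,|\,[\alpha]_q\right\rangle_0=1,$$ and let $\mathbf{v}_{\alpha}(x)$ be the infinite column vector $$\mathbf{v}_\alpha(x)=\left(1,\;x,\;\left\langle x|[\alpha]_q\right\rangle_2,\;\left\langle x|[\alpha]_q\right\rangle_3,\ldots,\left\langle x|[\alpha]_q\right\rangle_n,\ldots\right)^T,$$ whose $n$-th entry ($n=0,1,2,\dots$) is $\left\langle x|[\alpha]_q\right\rangle_n$. For numbers $a$ and an integer $n\ge0$ let $[t|a]_n=\prod_{j=0}^{n-1}(t-a^j)$, $[t|a]_0=1$. For real or complex $a,b,c$ the exponential-type Stirling numbers $S[n,k;a,b,c]$ ($n,k\ge 0$, with $S[n,k;a,b,c]=0$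 for $k>n$) are defined by the polynomial identities in $t$ $$[t|a]_n=\sum_{k=0}^{n}S[n,k;a,b,c]\,[t-c|b]_k,\qquad n\ge 0.$$ The unified generalized $q$-Stirling numbers are $$\sigma^1[n,k;\alpha,\beta,\gamma]_q=S[n,k;q^\alpha,q^\beta,q^\gamma-1]\,(q-1)^{k-n},\qquad \sigma^2[n,k;\alpha,\beta,\gamma]_q=S[n,k;q^\beta,q^\alpha,1-q^\gamma]\,(q-1)^{k-n}.$$ The unified generalized $q$-Stirling matrices $\sigma^1_{\alpha,\beta,\gamma}$ and $\sigma^2_{\alpha,\beta,\gamma}$ are the infinite lower triangular matrices, with rows and columns indexed by $n,k=0,1,2,\ldots$, whose $(n,k)$ entries are $\sigma^1[n,k;\alpha,\beta,\gamma]_q$ and $\sigma^2[n,k;\alpha,\beta,\gamma]_q$ respectively (zero for $k>n$). Products of lower triangular matrices with each other or with column vectors are well defined since each row has finitely many nonzero entries. *)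

(* Defs.v *)
From mathcomp Require Import all_boot all_order all_algebra.
From mathcomp Require Import all_classical all_reals all_analysis.

Set Implicit Arguments.
Unset Strict Implicit.
Unset Printing Implicit Defensive.

Import Order.TTheory GRing.Theory Num.Theory.

Local Open Scope classical_set_scope.
Local Open Scope ring_scope.

(* [t|a]_n; instantiated at {poly A} when t is an indeterminate. *)
Definition expfact (A : comNzRingType) (t a : A) (n : nat) : A := \prod_(j < n) (t - a ^+ j).

Section StirlingNumbers.
Variable A : comNzRingType.
Implicit Types (a b c : A) (S : nat -> nat -> A).

Definition is_exp_stirling a b c S : Prop :=
  (forall n k, (n < k)%N -> S n k = 0) /\
  (forall n, expfact 'X a%:P n =
     \sum_(k < n.+1) S n k *: expfact ('X - c%:P) b%:P k).

(* S[n,k;a,b,c]; exp_stirling_unique shows that the identities in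
   is_exp_stirling determine it, so the default value is never taken. *)
Definition exp_stirling a b c : nat -> nat -> A :=
  xget (fun _ _ => 0) [set S | is_exp_stirling a b c S].

Lemma expfactS_polyE a c n :
  expfact ('X - c%:P) a%:P n.+1 =
  expfact ('X - c%:P) a%:P n * ('X - (c + a ^+ n)%:P).
Proof.
by rewrite /expfact big_ord_recr /= polyCD opprD addrA polyC_exp.
Qed.

Lemma expfact_monic_size a c n :
  expfact ('X - c%:P) a%:P n \is monic /\
  size (expfact ('X - c%:P) a%:P n) = n.+1.
Proof.
elim: n => [|n [IHm IHs]].
  by rewrite /expfact big_ord0 monic1 size_poly1.
rewrite expfactS_polyE monicMl ?monicXsubC //; split=> //.
by rewrite size_Mmonic ?monicXsubC ?monic_neq0 // IHs size_XsubC addn2.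
Qed.

Lemma expfact_free b c n (s : nat -> A) :
  \sum_(k < n) s k *: expfact ('X - c%:P) b%:P k = 0 ->
  forall k, (k < n)%N -> s k = 0.
Proof.
elim: n => [|n IHn] // s0.
suff sn0 : s n = 0.
  move=> k; rewrite ltnS leq_eqVlt => /orP[/eqP-> //|]; apply: IHn.
  by move: s0; rewrite big_ord_recr /= sn0 scale0r addr0.
move/(congr1 (fun p : {poly A} => p`_n)): s0.
rewrite big_ord_recr /= coefD coef_sum coef0 big1 ?add0r; last first.
  move=> i _; rewrite coefZ nth_default ?mulr0 //.
  by have [_ ->] := expfact_monic_size b c i.
have [/monicP + sz] := expfact_monic_size b c n.
by rewrite coefZ lead_coefE sz /= => ->; rewrite mulr1.
Qed.

Lemma exp_stirling_ex a b c : exists S, is_exp_stirling a b c S.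
Proof.
pose B := expfact ('X - c%:P) b%:P.
pose row n (s : nat -> A) := (forall k, (n < k)%N -> s k = 0) /\
  expfact 'X a%:P n = \sum_(k < n.+1) s k *: B k.
suff /choice[S HS] : forall n, exists s, row n s.
  by exists S; split=> [n|n]; have [] := HS n.
elim=> [|n [s [s0 sE]]].
  exists (fun k => (k == 0%N)%:R); split=> [[|k] //|].
  by rewrite big_ord1 scale1r /B /expfact !big_ord0.
pose d k := c + b ^+ k - a ^+ n.
exists (fun k => (if k is k'.+1 then s k' else 0) + d k * s k); split.
  by move=> [|k] // nk; rewrite !s0 ?mulr0 ?addr0 // ltnW.
under eq_bigr do rewrite scalerDl.
rewrite big_split /= big_ord_recl /= scale0r add0r.
rewrite [X in _ + X]big_ord_recr /= s0 // mulr0 scale0r addr0.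
rewrite -big_split /= /expfact big_ord_recr /= -/(expfact _ _ _) sE mulr_suml.
apply: eq_bigr => i _.
rewrite /bump /= add1n /B expfactS_polyE -/B -polyC_exp.
have -> : 'X - (a ^+ n)%:P = 'X - (c + b ^+ i)%:P + (d i)%:P :> {poly A}.
  by rewrite /d (polyCB (c + b ^+ i)) addrA subrK.
rewrite mulrDr -!scalerAl; congr (_ + _).
by rewrite [B i * _]mulrC mul_polyC scalerA mulrC.
Qed.

Lemma exp_stirling_unique a b c S :
  is_exp_stirling a b c S <-> S = exp_stirling a b c.
Proof.
have HP : is_exp_stirling a b c (exp_stirling a b c).
  exact: (xgetPex _ (exp_stirling_ex a b c)).
split=> [[S0 SE]|-> //]; have [P0 PE] := HP.
apply/funext => n; apply/funext => k; apply/eqP; rewrite -subr_eq0; apply/eqP.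
have [nk|kn] := ltnP n k; first by rewrite S0 // P0 // subrr.
apply: (@expfact_free b c n.+1 (fun k => S n k - exp_stirling a b c n k)) => //.
under eq_bigr do rewrite scalerBl.
by rewrite sumrB -SE -PE subrr.
Qed.

End StirlingNumbers.

(* Infinite column vectors are nat -> A and infinite matrices are
   nat -> nat -> A.  The sum is the finitely supported one: it is meaningful
   when every row of M has finitely many nonzero entries. *)
Definition infmulmv (A : comNzRingType) (M : nat -> nat -> A) (v : nat -> A) :
    nat -> A :=
  fun n => \sum_(k \in [set: nat]) M n k * v k.

Section QStirling.
Variables (R : realType) (q : R).
Implicit Types x alpha beta gamma : R.

Definition qnum x : R := (q `^ x - 1) / (q - 1).

Definition qfact alpha x (n : nat) : R :=
  \prod_(j < n) (x - qnum (alpha * j%:R)).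

Definition qvec alpha x : nat -> R := fun n => qfact alpha x n.

(* The exponent k - n is a (possibly negative) integer. *)
Definition sigma1 alpha beta gamma : nat -> nat -> R := fun n k =>
  exp_stirling (q `^ alpha) (q `^ beta) (q `^ gamma - 1) n k
    * (q - 1) ^ (k%:Z - n%:Z).

Definition sigma2 alpha beta gamma : nat -> nat -> R := fun n k =>
  exp_stirling (q `^ beta) (q `^ alpha) (1 - q `^ gamma) n k
    * (q - 1) ^ (k%:Z - n%:Z).

End QStirling.

(* Main.v *)
Require Import Defs.
From mathcomp Require Import all_boot all_order all_algebra.
From mathcomp Require Import all_classical all_reals all_analysis.
From mathcomp Require Import ring.

Import Order.TTheory GRing.Theory Num.Theory.

Local Open Scope ring_scope.

(** Put [X = 1 + (q - 1) x].  Then [x - [alpha j]_q = (X - (q^alpha)^j) / (q - 1)],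
    so [<x|[alpha]_q>_n = (q - 1)^(-n) [X|q^alpha]_n], and the shift of [X] by [c]
    is the shift of [x] by [c / (q - 1)].  Both identities are then the defining
    identity of [S[n,k;a,b,c]] evaluated at [X], for [c = q^gamma - 1] and
    [c = 1 - q^gamma] respectively. *)

Lemma exp_stirlingP (A : comNzRingType) (a b c : A) :
  is_exp_stirling a b c (exp_stirling a b c).
Proof. exact/exp_stirling_unique. Qed.

Lemma horner_expfact (A : comNzRingType) (p : {poly A}) (a x : A) (n : nat) :
  (expfact p a%:P n).[x] = expfact p.[x] a n.
Proof.
rewrite /expfact horner_prod; apply: eq_bigr => j _.
by rewrite hornerD hornerN -polyC_exp hornerC.
Qed.

(** The defining identity of the Stirling numbers holds between polynomials, so it may be evaluated
    at any point [x]. *)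
Lemma expfact_exp_stirling (A : comNzRingType) (a b c x : A) (n : nat) :
  expfact x a n =
  \sum_(k < n.+1) exp_stirling a b c n k * expfact (x - c) b k.
Proof.
have [_ /(_ n)/(congr1 (horner^~ x))] := exp_stirlingP A a b c.
rewrite horner_expfact hornerX horner_sum => ->; apply: eq_bigr => k _.
by rewrite hornerZ horner_expfact hornerXsubC.
Qed.

Lemma infmulmv_lower_triangular (A : comNzRingType) (M : nat -> nat -> A)
    (v : nat -> A) (n : nat) :
    (forall k, (n < k)%N -> M n k = 0) ->
  infmulmv M v n = \sum_(k < n.+1) M n k * v k.
Proof.
move=> M0; rewrite (fsbig_ord +%R n.+1 (fun k => M n k * v k)).
(* Enlarging the index set from [k < n.+1] to all of [nat] adds only zero terms. *)
apply/esym/fsbig_widen => // k [_ /= kn].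
by rewrite M0 ?mul0r // ltnNge; apply/negP.
Qed.

Lemma qfact_expfact (R : realType) (q alpha x : R) (n : nat) :
    q - 1 != 0 ->
  qfact q alpha x n = expfact (1 + (q - 1) * x) (q `^ alpha) n / (q - 1) ^+ n.
Proof.
move=> q_neq1; rewrite /qfact /expfact.
have -> : (q - 1) ^+ n = \prod_(j < n) (q - 1) by rewrite prodr_const card_ord.
rewrite -prodf_div; apply: eq_bigr => j _.
(* Here [q^(alpha j)] becomes [(q^alpha)^j], a natural power of the base. *)
by rewrite /qnum powRrM powR_mulrn ?powR_ge0 //; field.
Qed.

(** With [c] left free, this covers both matrices; the second one exchanges [alpha] and [beta]. *)
Lemma qvec_exp_stirling (R : realType) (q alpha beta c x : R) :
    q - 1 != 0 ->
  qvec q alpha x =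
  infmulmv (fun n k => exp_stirling (q `^ alpha) (q `^ beta) c n k
                         * (q - 1) ^ (k%:Z - n%:Z))
           (qvec q beta (x - c / (q - 1))).
Proof.
move=> q_neq1; apply/funext => n; rewrite infmulmv_lower_triangular; last first.
  move=> k nk; have [-> //] := exp_stirlingP R (q `^ alpha) (q `^ beta) c.
  by rewrite mul0r.
rewrite /qvec qfact_expfact // (expfact_exp_stirling R _ (q `^ beta) c) mulr_suml.
(* In [(q - 1)^(k - n)], the factor [(q - 1)^k] cancels the denominator of the [beta] factorial, and
   [(q - 1)^(-n)] matches that of the left side. *)
apply: eq_bigr => k _; rewrite qfact_expfact // expfzDr // -exprnN -exprnP.
have -> : 1 + (q - 1) * (x - c / (q - 1)) = 1 + (q - 1) * x - c by field.
by field; rewrite !expf_neq0.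
Qed.

Theorem theorem2p3 (R : realType) (q : R) (hq0 : 0 < q) (hq1 : q <> 1)
    (alpha beta gamma : R) :
  forall t : R,
    qvec q alpha (qnum q t) =
      infmulmv (sigma1 q alpha beta gamma)
               (qvec q beta (qnum q t - qnum q gamma)) /\
    qvec q beta (qnum q t) =
      infmulmv (sigma2 q alpha beta gamma)
               (qvec q alpha (qnum q t + qnum q gamma)).
Proof.
move=> t; have q_neq1 : q - 1 != 0 by rewrite subr_eq0; apply/eqP.
(* For [c = q^gamma - 1], the quotient [c / (q - 1)] is [[gamma]_q] by definition. *)
split; first exact: qvec_exp_stirling.
have -> : qnum q t + qnum q gamma = qnum q t - (1 - q `^ gamma) / (q - 1).
  by rewrite /qnum -mulNr opprB.
exact: qvec_exp_stirling.
Qed.
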